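(* Let $\mathcal{C}=\{\mathcal{E}_i\}_i$ be a class of quantum channels $\mathcal{E}_i:\mathcal{S}_N\to\mathcal{S}_N$. Suppose there exists a learning algorithm that learns $\mathcal{C}$ using $q$ queries to the oracle $\mathsf{QPStat}_{\mathcal{E}}$, for an unknown channel $\mathcal{E}\in\mathcal{C}$, with tolerance at least $\tau$, for observables $\{O_j\}_{j\in[q]}$ with $\|O_j\|_\infty\le 1$ for all $j\in[q]$. Let $\Lambda$ be any unknown noise channel (which transforms each channel $\mathcal{E}_i$ into a noisy channel $\Lambda(\mathcal{E}_i)$ on $\mathcal{S}_N$) with the guarantee that, for some $\eta$ with $0<\eta<\tau$ and for all $\mathcal{E}_i\in\mathcal{C}$, $$\|\Lambda(\mathcal{E}_i)-\mathcal{E}_i\|_\diamond\le\eta .$$ Then there exists an algorithm for learning $\mathcal{C}$ given access to $\mathsf{QPStat}_{\Lambda(\mathcal{E}_i)}$ (where $\mathcal{E}_i\in\mathcal{C}$ is the unknown channel to be learned), using $q$ queries of tolerance at least $\tau-\eta$.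
   Context: $\mathcal{S}_N$ is the set of density matrices on $\mathbb{C}^N$, and a quantum channel is a completely positive trace-preserving (CPTP) map. $\|\cdot\|_\infty$ is the operator norm. The diamond norm of a map $\mathcal{E}$ on $N\times N$ matrices is $\|\mathcal{E}\|_\diamond=\max_{\rho\in\mathcal{S}_{N^2}}\|(\mathcal{E}\otimes\mathcal{I})(\rho)\|_1$, with $\mathcal{I}$ the identity map on $N\times N$ matrices and $\|\cdot\|_1$ the Schatten 1-norm. $[q]=\{1,\dots,q\}$. Oracle: for a quantum channel $\mathcal{E}:\mathcal{S}_N\to\mathcal{S}_N$, the oracle $\mathsf{QPStat}_{\mathcal{E}}$ takes as input a Hermitian $N\times N$ observable $O$ with $\|O\|_\infty\le1$, a state $\rho\in\mathcal{S}_N$ and a tolerance $\tau>0$, and returns some $\alpha\in\mathbb{R}$ satisfying $|\alpha-\operatorname{Tr}(O\mathcal{E}(\rho))|\le\tau$ (any such value may be returned). Learning: an algorithm learns the class $\mathcal{C}$ from a given oracle if, for every unknown $\mathcal{E}\in\mathcal{C}$ and every valid sequence of oracle responses, it outputs a hypothesis meeting the prescribed success criterion (e.g. accuracy and success probability) with respect to $\mathcal{E}$; the success criterion is the same in the noiseless and noisy settings, and in the noisy setting the target to be learned is still the noiseless channel $\mathcal{E}_i$. *)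

(* Defs.v *)
From mathcomp Require Import all_boot all_order all_algebra.
From mathcomp Require Import boolp classical_sets reals constructive_ereal ereal.
From mathcomp Require Import sesquilinear spectral.
From mathcomp Require Import complex.
From mathcomp Require mxtens.

Set Implicit Arguments.
Unset Strict Implicit.
Unset Printing Implicit Defensive.

Import Order.TTheory GRing.Theory Num.Theory.

Local Open Scope ring_scope.
Local Open Scope complex_scope.
Local Open Scope sesquilinear_scope.
Local Open Scope classical_set_scope.

Section Matrices.
Context {R : realType}.
Notation C := R[i].

Definition psdmx n (A : 'M[C]_n) : Prop :=
  A \is hermsymmx /\ forall v : 'cV[C]_n, 0 <= (v^t* *m A *m v) 0 0.

Definition density n (rho : 'M[C]_n) : Prop := psdmx rho /\ \tr rho = 1.

Definition l2norm n (v : 'cV[C]_n) : R :=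
  Num.sqrt (\sum_i complex.Re `|v i 0| ^+ 2).

Definition opnorm n (A : 'M[C]_n) : \bar R :=
  ereal_sup [set (l2norm (A *m v))%:E | v in [set v | l2norm v <= 1]].

(* The sum of the singular values of [A], that is the trace of
   [sqrt (A^t* *m A)]; [A^t* *m A] is normal with nonnegative eigenvalues, which
   [spectral_diag] lists with multiplicity. *)
Definition trace_norm n (A : 'M[C]_n) : R :=
  \sum_i Num.sqrt (complex.Re (spectral_diag (A^t* *m A) 0 i)).

(* [E] tensored with the identity on [k x k] matrices: [A] is written as the sum
   over [i, j] of [A_ij] tensor [delta_mx i j], and [E] is applied to the [A_ij].
   The map [E] is only assumed to be a function so that differences of channels
   are covered; the definition is meaningful for linear [E]. *)
Definition ampliation n k (E : 'M[C]_n -> 'M[C]_n) (A : 'M[C]_(n * k)) :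
    'M[C]_(n * k) :=
  \sum_(i < k) \sum_(j < k)
    mxtens.tensmx
      (E (\matrix_(a, b) A (mxtens.mxtens_index (a, i))
                           (mxtens.mxtens_index (b, j))))
      (delta_mx i j).

(* The supremum is valued in the extended reals, so that no boundedness or
   attainment has to be established beforehand. *)
Definition diamond_norm n (E : 'M[C]_n -> 'M[C]_n) : \bar R :=
  ereal_sup [set (trace_norm (ampliation E rho))%:E
            | rho in [set rho : 'M[C]_(n * n) | density rho]].

Definition completely_positive n (E : 'M[C]_n -> 'M[C]_n) : Prop :=
  forall k (A : 'M[C]_(n * k)), psdmx A -> psdmx (ampliation E A).

Definition trace_preserving n (E : 'M[C]_n -> 'M[C]_n) : Prop :=
  forall A : 'M[C]_n, \tr (E A) = \tr A.

End Matrices.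

Record channel (R : realType) (N : nat) := Channel {
  channel_fun :> {linear 'M[R[i]]_N -> 'M[R[i]]_N};
  channel_cp : completely_positive channel_fun;
  channel_tp : trace_preserving channel_fun }.

Record query (R : realType) (N : nat) := Query {
  observable : 'M[R[i]]_N;
  state : 'M[R[i]]_N;
  tolerance : R;
  observable_herm : observable \is hermsymmx;
  observable_norm : (opnorm observable <= 1%:E)%E;
  state_density : density state;
  tolerance_gt0 : 0 < tolerance }.

(* An oracle may answer depending on all the previous queries and answers. It
   does not see the internal randomness of the algorithm that queries it. *)
Definition oracle (R : realType) (N : nat) : Type :=
  seq (query R N * R) -> query R N -> R.

Definition is_QPStat (R : realType) (N : nat) (E : channel R N)
    (orc : oracle R N) : Prop :=
  forall past x,
    `|(orc past x)%:C - \tr (observable x *m E (state x))| <= (tolerance x)%:C.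

(* An algorithm making queries adaptively: the next query and the final
   hypothesis depend on the internal randomness [w : Omega] and on the answers
   received so far, in order. *)
Record algorithm (R : realType) (N : nat) (Omega Hyp : Type) := Algorithm {
  ask : Omega -> seq R -> query R N;
  output : Omega -> seq R -> Hyp }.

Section Learning.
Context {R : realType} {N : nat} {Omega Hyp : Type}.

Fixpoint transcript (A : algorithm R N Omega Hyp) (orc : oracle R N) (w : Omega)
    (q : nat) : seq (query R N * R) :=
  if q is q'.+1 then
    let past := transcript A orc w q' in
    let x := ask A w [seq s.2 | s <- past] in
    rcons past (x, orc past x)
  else [::].

Definition outcome (A : algorithm R N Omega Hyp) (q : nat) (orc : oracle R N) :
    Omega -> Hyp :=
  fun w => output A w [seq s.2 | s <- transcript A orc w q].

Definition tolerance_at_least (A : algorithm R N Omega Hyp) (q : nat) (tau : R) :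
    Prop :=
  forall w (answers : seq R), (size answers < q)%N ->
    tau <= tolerance (ask A w answers).

(* [success E X] is the criterion to be met with respect to the channel [E] by the
   hypothesis [X : Omega -> Hyp], a function of the internal randomness; for
   instance, "[P [set w | accurate E (X w)] >= 1 - delta]" for a probability [P]
   on [Omega], or "[forall w, accurate E (X w)]". The oracle is one for
   [noise E], but success is judged with respect to [E]. *)
Definition learns (success : channel R N -> (Omega -> Hyp) -> Prop)
    (CC : set (channel R N)) (noise : channel R N -> channel R N)
    (q : nat) (A : algorithm R N Omega Hyp) : Prop :=
  forall E, CC E -> forall orc, is_QPStat (noise E) orc ->
    success E (outcome A q orc).

End Learning.

(* Main.v *)
Require Import Defs.
From mathcomp Require Import all_boot all_order all_algebra.
From mathcomp Require Import boolp classical_sets reals constructive_ereal ereal.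
From mathcomp Require Import complex.
From mathcomp Require Import sesquilinear spectral.
From mathcomp Require mxtens.

Set Implicit Arguments.
Unset Strict Implicit.
Unset Printing Implicit Defensive.

Import Order.TTheory GRing.Theory Num.Theory.

Local Open Scope ring_scope.

(* Run the given algorithm with every tolerance [t] replaced by [t - eta]. For
   [||O|| <= 1] and a state [rho], [|Tr(O F(rho)) - Tr(O E(rho))|] is at most the
   diamond norm of [F - E]: test the latter on [rho tensor e_i e_i^*] and use that
   [|Tr(B M)| <= ||M||_1] for a contraction [B]. So an answer valid for the noisy
   channel within [t - eta] is valid for the noiseless one within [t], and a run
   against the noisy oracle is also a run of the original algorithm against an
   oracle for the noiseless channel. *)

(** * Contractions, trace norm and ampliations *)

Section ContractionsAndTraceNorm.
Context {R : realType}.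
Local Notation C := R[i].
Local Open Scope complex_scope.
Local Open Scope sesquilinear_scope.

Implicit Types m n p k : nat.

Lemma adjmx_mul m n p (A : 'M[C]_(m, n)) (B : 'M[C]_(n, p)) :
  (A *m B)^t* = B^t* *m A^t*.
Proof. by rewrite trmx_mul map_mxM. Qed.

Lemma hermsymmxP n (A : 'M[C]_n) : reflect (A^t* = A) (A \is hermsymmx).
Proof.
by apply: (iffP (is_hermitianmxP _ _ _)); rewrite expr0 scale1r => /esym.
Qed.

Lemma mxtrace_adj n (A : 'M[C]_n) : \tr (A^t*) = (\tr A)^*%R.
Proof. by rewrite trace_map_mx mxtrace_tr. Qed.

Lemma trace_herm_mul_real n (A B : 'M[C]_n) :
  A \is hermsymmx -> B \is hermsymmx -> \tr (A *m B) \is Num.real.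
Proof.
move=> /hermsymmxP hA /hermsymmxP hB; apply/CrealP.
by rewrite -mxtrace_adj adjmx_mul hA hB mxtrace_mulC.
Qed.

Lemma l2norm_ge0 n (v : 'cV[C]_n) : 0 <= l2norm v.
Proof. exact: sqrtr_ge0. Qed.

Lemma l2norm_sqr n (v : 'cV[C]_n) : (l2norm v ^+ 2)%:C = (v^t* *m v) 0 0.
Proof.
rewrite sqr_sqrtr; last by apply: sumr_ge0 => i _; rewrite sqr_ge0.
rewrite rmorph_sum mxE; apply: eq_bigr => i _.
by rewrite !mxE rmorphXn -normCKC; congr (_ ^+ 2); apply: RRe_real.
Qed.

Lemma sqrtC_l2norm n (v : 'cV[C]_n) : sqrtC ((v^t* *m v) 0 0) = (l2norm v)%:C.
Proof. by rewrite -l2norm_sqr rmorphXn /= sqrCK// ler0c l2norm_ge0. Qed.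

Lemma cauchy_schwarz n (u v : 'cV[C]_n) :
  `|(u^t* *m v) 0 0| <= (l2norm u * l2norm v)%:C.
Proof.
(* [dotmx] pairs row vectors, so it is applied to the adjoints of the columns [u] and [v]. *)
have := (CauchySchwarz_sqrt (@dotmx C n) (u^t*) (v^t*)).1.
by rewrite /= !dotmxE !trmxCK !sqrtC_l2norm -rmorphM.
Qed.

Lemma l2norm_isometry m n (V : 'M[C]_(m, n)) (v : 'cV[C]_n) :
  V^t* *m V = 1%:M -> l2norm (V *m v) = l2norm v.
Proof.
move=> VV; apply: complexI; rewrite -!sqrtC_l2norm adjmx_mul.
by rewrite -mulmxA [V^t* *m _]mulmxA VV mul1mx.
Qed.

(** Cauchy-Schwarz for [v] and [V V^* v] bounds [||V^* v||^2] by [||v|| ||V^* v||], because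
    [||V V^* v|| = ||V^* v||]; then one factor is cancelled unless it vanishes. *)
Lemma l2norm_coisometry m n (V : 'M[C]_(m, n)) (v : 'cV[C]_m) :
  V^t* *m V = 1%:M -> l2norm (V^t* *m v) <= l2norm v.
Proof.
move=> VV; have := cauchy_schwarz v (V *m (V^t* *m v)).
rewrite l2norm_isometry// mulmxA -{1}[V]trmxCK -adjmx_mul.
rewrite -l2norm_sqr ger0_norm ?ler0c ?sqr_ge0// lecR expr2.
have [->|nz] := eqVneq (l2norm (V^t* *m v)) 0; first by rewrite l2norm_ge0.
by rewrite ler_pM2r// lt_neqAle eq_sym nz l2norm_ge0.
Qed.

Lemma l2normZ n (c : R) (v : 'cV[C]_n) :
  0 <= c -> l2norm (c%:C *: v) = c * l2norm v.
Proof.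
move=> c0; apply: complexI; rewrite rmorphM /= -!sqrtC_l2norm.
have cc : (c%:C)^*%R = c%:C :> C.
  by apply: conj_Creal; apply/complex_realP; exists c.
have -> : (c%:C *: v)^t* = c%:C *: v^t*.
  by apply/matrixP => a b; rewrite !mxE rmorphM /= cc.
rewrite -scalemxAl -scalemxAr scalerA mxE.
rewrite -expr2 rootCMl ?exprn_ge0 ?ler0c//.
by rewrite sqrCK ?ler0c.
Qed.

Lemma l2norm_eq0 n (v : 'cV[C]_n) : l2norm v = 0 -> v = 0.
Proof.
move=> v0; have := @dnorm_eq0 _ _ (@dotmx C n) (v^t*).
rewrite /= dotmxE trmxCK -l2norm_sqr v0 expr0n eqxx => /esym/eqP e.
by rewrite -[v]trmxCK e trmx0 map_mx0.
Qed.

Lemma opnorm_le1 n (A : 'M[C]_n) (v : 'cV[C]_n) :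
  (opnorm A <= 1%:E)%E -> l2norm (A *m v) <= l2norm v.
Proof.
move=> A1; have [v0|nz] := eqVneq (l2norm v) 0.
  by rewrite (l2norm_eq0 v0) mulmx0.
have vgt0 : 0 < l2norm v by rewrite lt_neqAle eq_sym nz l2norm_ge0.
have ivge0 : 0 <= (l2norm v)^-1 by rewrite invr_ge0 ltW.
have : ((l2norm (A *m ((l2norm v)^-1%:C *: v)))%:E <= 1%:E :> \bar R)%E.
  apply: le_trans A1; apply: ereal_sup_ubound => /=.
  by exists ((l2norm v)^-1%:C *: v) => //=; rewrite l2normZ// mulVf.
by rewrite -scalemxAr l2normZ// lee_fin ler_pdivrMl// mulr1.
Qed.

(* Evaluate the trace in an orthonormal basis [u_i] of eigenvectors of
   [M^t* *m M]: by Cauchy-Schwarz [|<u_i, B M u_i>| <= ||M u_i||], which is the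
   [i]-th singular value of [M]. *)
Lemma trace_norm_duality n (B M : 'M[C]_n) :
  (forall v : 'cV[C]_n, l2norm (B *m v) <= l2norm v) ->
  `|\tr (B *m M)| <= (trace_norm M)%:C.
Proof.
move=> B1; set H := M^t* *m M.
have nH : H \is normalmx.
  by apply/hermitian_normalmx/hermsymmxP; rewrite /H adjmx_mul trmxCK.
set U := spectralmx H; have uU : U \is unitarymx := spectral_unitarymx H.
have UU : U *m U^t* = 1%:M by apply/unitarymxP.
have UU' : U^t* *m U = 1%:M by rewrite -invmx_unitary// mulVmx// spectral_unit.
have HE : U *m H *m U^t* = diag_mx (spectral_diag H).
  rewrite [H in LHS](orthomx_spectralP nH) -/U invmx_unitary// !mulmxA UU mul1mx.
  by rewrite -mulmxA UU mulmx1.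
have -> : \tr (B *m M) = \tr (U *m (B *m M) *m U^t*).
  by rewrite [RHS]mxtrace_mulC mulmxA UU' mul1mx.
rewrite /trace_norm /mxtrace rmorph_sum; apply: (le_trans (ler_norm_sum _ _ _)).
apply: ler_sum => i _; pose u := col i (U^t*).
have uE (X : 'M[C]_n) : (U *m X *m U^t*) i i = (u^t* *m (X *m u)) 0 0.
  have -> : u^t* = row i U by apply/matrixP=> a b; rewrite !mxE conjCK.
  rewrite mulmxA /u -row_mul !mxE.
  by apply: eq_bigr => j _; rewrite !mxE.
(* The identity [uE] at [X = 1] reads [||u||^2] off the diagonal of [U U^* = 1]. *)
have u1 : l2norm u = 1.
  apply: complexI; rewrite -sqrtC_l2norm -[X in _ *m X]mul1mx -uE mulmx1 UU.
  by rewrite mxE eqxx sqrtC1.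
rewrite uE -mulmxA; apply: (le_trans (cauchy_schwarz _ _)).
rewrite u1 mul1r lecR; apply: (le_trans (B1 _)).
have := uE H; rewrite HE mxE eqxx mulr1n => ->.
have -> : u^t* *m (H *m u) = (M *m u)^t* *m (M *m u).
  by rewrite adjmx_mul /H !mulmxA.
by rewrite -l2norm_sqr /= sqrtr_sqr ler_norm.
Qed.

(* The isometry [v |-> v tensor e_i]. *)
Definition tens_delta n k (i : 'I_k) : 'M[C]_(n * k, n) :=
  \matrix_(p, a) (p == mxtens.mxtens_index (a, i))%:R.

Lemma tens_delta_isometry n k (i : 'I_k) :
  (tens_delta n i)^t* *m tens_delta n i = 1%:M.
Proof.
apply/matrixP => a b; rewrite !mxE (bigD1 (mxtens.mxtens_index (b, i)))//=.
rewrite big1 ?addr0 => [|p /negPf nb]; last by rewrite !mxE nb mulr0.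
rewrite !mxE eqxx mulr1 rmorph_nat.
rewrite (can_eq (@mxtens.mxtens_indexK n k)) xpair_eqE eqxx andbT.
by rewrite eq_sym.
Qed.

Lemma tens_delta_conj n k (i : 'I_k) (X : 'M[C]_n) a b j l :
  (tens_delta n i *m X *m (tens_delta n i)^t*)
    (mxtens.mxtens_index (a, j)) (mxtens.mxtens_index (b, l)) =
  X a b * ((j == i) && (l == i))%:R.
Proof.
rewrite mxE (bigD1 b)//= big1 ?addr0 => [|c /negPf nc]; last first.
  rewrite !mxE (can_eq (@mxtens.mxtens_indexK n k)) xpair_eqE.
  by rewrite eq_sym nc conjC0 mulr0.
rewrite !mxE (bigD1 a)//= big1 ?addr0 => [|c /negPf nc]; last first.
  rewrite !mxE (can_eq (@mxtens.mxtens_indexK n k)) xpair_eqE.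
  by rewrite eq_sym nc mul0r.
rewrite !mxE !(can_eq (@mxtens.mxtens_indexK n k)) !xpair_eqE !eqxx /=.
by rewrite rmorph_nat mulrAC -natrM mulnb mulrC.
Qed.

(** Viewed as a [k] by [k] array of blocks, [X tensor e_i e_i^*] has [X] in position [(i, i)] and
    [0] elsewhere; [E] acts blockwise and keeps the zero blocks by [E 0 = 0]. *)
Lemma ampliation_tens_delta n k (i : 'I_k) (E : 'M[C]_n -> 'M[C]_n)
    (X : 'M[C]_n) : E 0 = 0 ->
  ampliation E (tens_delta n i *m X *m (tens_delta n i)^t*) =
  tens_delta n i *m E X *m (tens_delta n i)^t*.
Proof.
move=> E0; apply/matrixP => p q.
case: (mxtens.mxtens_indexP p) => a j; case: (mxtens.mxtens_indexP q) => b l.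
rewrite tens_delta_conj /ampliation summxE (bigD1 j)//= [X in _ + X]big1 ?addr0;
    last first.
  move=> j' /negPf nj; rewrite summxE big1// => l' _.
  by rewrite mxtens.tensmxE !mxE eq_sym nj mulr0.
rewrite summxE (bigD1 l)//= [X in _ + X]big1 ?addr0;
    last first.
  move=> l' /negPf nl.
  by rewrite mxtens.tensmxE !mxE [l == _]eq_sym nl andbF mulr0.
rewrite mxtens.tensmxE mxE !eqxx mulr1.
have -> : (\matrix_(c, d) (tens_delta n i *m X *m (tens_delta n i)^t*)
    (mxtens.mxtens_index (c, j)) (mxtens.mxtens_index (d, l))) =
    if (j == i) && (l == i) then X else 0.
  apply/matrixP => c d; rewrite mxE tens_delta_conj.
  by case: ifP; rewrite ?mulr1 ?mulr0 ?mxE.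
by case: ifP; rewrite ?mulr1 ?mulr0 ?E0 ?mxE.
Qed.

Lemma psdmx_conj m n (V : 'M[C]_(m, n)) (A : 'M[C]_n) :
  psdmx A -> psdmx (V *m A *m V^t*).
Proof.
move=> [/hermsymmxP hA A0]; split.
  by apply/hermsymmxP; rewrite !adjmx_mul trmxCK hA mulmxA.
by move=> v; have := A0 (V^t* *m v); rewrite adjmx_mul trmxCK !mulmxA.
Qed.

Lemma density_conj m n (V : 'M[C]_(m, n)) (rho : 'M[C]_n) :
  V^t* *m V = 1%:M -> density rho -> density (V *m rho *m V^t*).
Proof.
move=> VV [rho0 tr1]; split; first exact: psdmx_conj.
by rewrite mxtrace_mulC mulmxA VV mul1mx.
Qed.

(** Take a one-dimensional ancilla: conjugate by the isometry [v |-> v tensor e_0], apply complete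
    positivity with [k = 1], and conjugate back by its adjoint. *)
Lemma completely_positive_psdmx n (E : 'M[C]_n -> 'M[C]_n) (A : 'M[C]_n) :
  E 0 = 0 -> completely_positive E -> psdmx A -> psdmx (E A).
Proof.
move=> E0 cpE /(psdmx_conj (@tens_delta n 1 0)) /cpE.
rewrite ampliation_tens_delta// => /(psdmx_conj ((@tens_delta n 1 0)^t*)).
rewrite trmxCK !mulmxA tens_delta_isometry mul1mx -mulmxA.
by rewrite tens_delta_isometry mulmx1.
Qed.

Lemma trace_le_diamond_norm n (E : 'M[C]_n -> 'M[C]_n) (O rho : 'M[C]_n)
    (eta : R) :
  E 0 = 0 -> (opnorm O <= 1%:E)%E -> density rho ->
  (diamond_norm E <= eta%:E)%E -> `|\tr (O *m E rho)| <= eta%:C.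
Proof.
move=> E0 O1 drho Eeta.
(* A basis vector [e_i] requires [n > 0]; for [n = 0] every trace is [0], so no density matrix
   exists. *)
have [n0|/card_gt0P[i _]] := posnP #|'I_n|.
  case: drho => _ /eqP; rewrite /mxtrace big_pred0 ?[_ == 1]eq_sym ?oner_eq0//.
  exact: (card0_eq n0).
pose V := tens_delta n i.
have VV : V^t* *m V = 1%:M := tens_delta_isometry _ _.
have -> : \tr (O *m E rho) =
    \tr ((V *m O *m V^t*) *m ampliation E (V *m rho *m V^t*)).
  rewrite ampliation_tens_delta// !mulmxA -[V *m O *m _ *m _]mulmxA VV mulmx1.
  by rewrite [RHS]mxtrace_mulC !mulmxA VV mul1mx.
apply: (@le_trans _ _ (trace_norm (ampliation E (V *m rho *m V^t*)))%:C).
  (* [V O V^*] is a contraction: [V] preserves the norm, while [O] and [V^*] do not increase it. *)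
  apply: trace_norm_duality => v; rewrite -!mulmxA l2norm_isometry//.
  by apply: le_trans (opnorm_le1 _ O1) _; apply: l2norm_coisometry.
rewrite lecR -lee_fin; apply: le_trans Eeta; apply: ereal_sup_ubound => /=.
by exists (V *m rho *m V^t*) => //; apply: density_conj.
Qed.

End ContractionsAndTraceNorm.

(** * Simulating a noiseless oracle by a noisy one *)

Section Simulation.
Context {R : realType} {N : nat} (eta : R).
Local Open Scope complex_scope.

Definition shrink (t : R) : R := if eta < t then t - eta else t.

Lemma shrink_gt0 t : 0 < t -> 0 < shrink t.
Proof. by rewrite /shrink; case: ifP; rewrite ?subr_gt0. Qed.

(* A tolerance at most [eta] is left unchanged, since a query must have positive
   tolerance; the first [q] queries never have such a tolerance. *)
Definition shrink_query (x : query R N) : query R N :=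
  Query (observable_herm x) (observable_norm x) (state_density x)
    (shrink_gt0 (tolerance_gt0 x)).

Definition shrink_algorithm {Omega Hyp : Type} (A : algorithm R N Omega Hyp) :
    algorithm R N Omega Hyp :=
  Algorithm (fun w answers => shrink_query (ask A w answers)) (output A).

Definition shrink_past (s : seq (query R N * R)) :=
  [seq (shrink_query x.1, x.2) | x <- s].

(** The second branch gives the exact value, so that the answer is valid for every query, also one
    of tolerance at most [eta]. This oracle may depend on the unknown [E]: it serves only to analyse
    the run, and the shrunk algorithm does not mention it. *)
Definition denoise (E : channel R N) (orc : oracle R N) : oracle R N :=
  fun past x =>
    if eta < tolerance x then orc (shrink_past past) (shrink_query x)
    else complex.Re (\tr (observable x *m E (state x))).

Lemma denoise_QPStat (E F : channel R N) (orc : oracle R N) :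
  (diamond_norm (F \- E)%R <= eta%:E)%E -> is_QPStat F orc ->
  is_QPStat E (denoise E orc).
Proof.
move=> EF orcP past x; rewrite /denoise; case: ifP => [lt_eta|_]; last first.
  (* The trace is real, as [O] and [E rho] are Hermitian, so taking its real part introduces no
     error. *)
  rewrite RRe_real ?subrr ?normr0 ?ler0c ?ltW ?tolerance_gt0//.
  apply: trace_herm_mul_real; first exact: observable_herm.
  apply: (proj1 (completely_positive_psdmx _ _ _)).
  - exact: raddf0.
  - exact: channel_cp.
  - exact: (state_density x).1.
have := orcP (shrink_past past) (shrink_query x).
rewrite /= /shrink lt_eta => le1.
have F0 : (F \- E)%R 0 = 0 by rewrite [LHS]raddf0.
have := trace_le_diamond_norm F0 (observable_norm x) (state_density x) EF.
rewrite /= mulmxBr raddfB /= => le2.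
rewrite -(subrK (\tr (observable x *m F (state x))) (_%:C)) -addrA.
apply: le_trans (ler_normD _ _) _.
by rewrite -[tolerance x](subrK eta) rmorphD lerD.
Qed.

(** By induction both runs have received the same answers, hence ask the same next query up to its
    tolerance; that tolerance exceeds [eta], so [denoise] forwards the query to [orc]. *)
Lemma transcript_shrink {Omega Hyp : Type} (A : algorithm R N Omega Hyp)
    (E : channel R N) (orc : oracle R N) (w : Omega) (q : nat) :
  (forall answers, (size answers < q)%N -> eta < tolerance (ask A w answers)) ->
  transcript (shrink_algorithm A) orc w q =
  shrink_past (transcript A (denoise E orc) w q).
Proof.
have answersE s : [seq x.2 | x <- shrink_past s] = [seq x.2 | x <- s].
  by rewrite -map_comp.
have size_transcript j : size (transcript A (denoise E orc) w j) = j.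
  by elim: j => //= j IH; rewrite size_rcons IH.
elim: q => //= q IH tolA; rewrite IH => [|answers lt_q]; last first.
  by apply: tolA; apply: ltnW.
rewrite answersE /shrink_past map_rcons -/(shrink_past _) /=.
(* After [q] rounds exactly [q] answers are recorded, which is within the range of [tolA] for
   [q.+1]. *)
by rewrite [denoise E orc _ (ask _ _ _)]/denoise tolA// size_map size_transcript.
Qed.

Lemma outcome_shrink {Omega Hyp : Type} (A : algorithm R N Omega Hyp)
    (E : channel R N) (orc : oracle R N) (q : nat) :
  (forall w answers, (size answers < q)%N ->
     eta < tolerance (ask A w answers)) ->
  outcome (shrink_algorithm A) q orc = outcome A q (denoise E orc).
Proof.
move=> tolA; apply/funext => w.
by rewrite /outcome (transcript_shrink E) ?/shrink_past -?map_comp//; exact: tolA.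
Qed.

End Simulation.

Theorem theorem1 (R : realType) (N : nat) (Omega Hyp : Type)
    (success : channel R N -> (Omega -> Hyp) -> Prop)
    (CC : set (channel R N)) (q : nat) (tau : R) :
  (exists A : algorithm R N Omega Hyp,
      tolerance_at_least A q tau /\ learns success CC idfun q A) ->
  forall eta : R, 0 < eta -> eta < tau ->
  exists B : algorithm R N Omega Hyp,
      tolerance_at_least B q (tau - eta) /\
      forall Lambda : channel R N -> channel R N,
        (forall E : channel R N, CC E ->
           (diamond_norm (Lambda E \- E)%R <= eta%:E)%E) ->
        learns success CC Lambda q B.
Proof.
move=> [A [tolA learnA]] eta eta_gt0 lt_eta.
have ltA w answers : (size answers < q)%N -> eta < tolerance (ask A w answers).
  by move=> lt_q; apply: lt_le_trans lt_eta (tolA _ _ lt_q).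
(* The witness depends on [A] and [eta] alone, so a single algorithm works for every unknown
   [Lambda]. *)
exists (shrink_algorithm eta A); split.
  move=> w answers lt_q; rewrite /= /shrink ltA//.
  by rewrite lerD2r tolA.
move=> Lambda noise E CCE orc orcP; rewrite (outcome_shrink E)//.
apply: learnA => //; apply: denoise_QPStat orcP; exact: noise.
Qed.
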